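(* Let $\beta=2^p$ for some $p\in\mathbb{N}$, and let $H=[A_{s,t}]_{1\le s,t\le\beta}\in \mathbb{M}_{\beta n}^+$ be written in $\beta\times \beta$ blocks $A_{s,t}\in\mathbb{M}_n$, all of which are Hermitian. Let $\Delta=\sum_{s=1}^{\beta}A_{s,s}$ and let $m=2^{\beta}$. Then $$\oplus^{m} H =\frac{1}{\beta} \sum_{k=1}^{\beta} V_k\left(\oplus^{m}\Delta\right) V_k^*$$ for some family $\{V_k\}_{k=1}^{\beta}$ of isometries in $\mathbb{M}_{m\beta n,mn}$.
   Context: $\mathbb{M}_n$ denotes the algebra of $n\times n$ matrices and $\mathbb{M}_{p,q}$ the space of matrices with $p$ rows and $q$ columns; the entries are either all real or all complex (the statement holds in each of the two cases, with the same field throughout; in the real case Hermitian means symmetric and $V^*$ is the transpose). $\mathbb{M}_n^+$ is the set of positive semi-definite matrices in $\mathbb{M}_n$. A matrix $V\in\mathbb{M}_{p,q}$ is an isometry if $p\ge q$ and $V^*V=I_q$. For a matrix $A$, $\oplus^m A$ is the block-diagonal matrix $A\oplus\cdots\oplus A$ with $m$ copies of $A$. The matrix $\Delta$ is called the partial trace of $H$. *)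

(* Defs.v *)
From HB Require Import structures.
From mathcomp Require Import all_boot all_order all_algebra.
From mathcomp Require Import reals.
From mathcomp Require Import complex.

Set Implicit Arguments.
Unset Strict Implicit.
Unset Printing Implicit Defensive.

Import Order.TTheory GRing.Theory Num.Theory.
Local Open Scope ring_scope.
Local Open Scope sesquilinear_scope.

(* [scalar_field R k] is either the real or the complex numbers, and [sconj R k]
   its conjugation, trivial in the real case, so that [adjmx] and
   [hermitian_mx] mean transposition and symmetry there. *)
Variant scalar_kind := RealScalars | ComplexScalars.

Definition scalar_field (R : realType) (k : scalar_kind) : numFieldType :=
  match k with
  | RealScalars => R
  | ComplexScalars => R[i]
  end.

Definition sconj (R : realType) (k : scalar_kind) :
    {rmorphism scalar_field R k -> scalar_field R k} :=
  match k with
  | RealScalars => idfun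
  | ComplexScalars => Num.conj
  end.

Section Matrices.
Variables (R : realType) (k : scalar_kind).
Local Notation F := (scalar_field R k).

Definition adjmx (p q : nat) (A : 'M[F]_(p, q)) : 'M[F]_(q, p) :=
  A ^t (sconj R k).

Definition hermitian_mx (n : nat) (A : 'M[F]_n) : Prop :=
  A \is hermitianmx n false (sconj R k).

(* Over [R[i]], [0 <= z] also says that [z] is real. *)
Definition psd_mx (n : nat) (A : 'M[F]_n) : Prop :=
  hermitian_mx A /\ forall x : 'cV[F]_n, 0 <= (adjmx x *m A *m x) 0 0.

Definition isometry_mx (p q : nat) (V : 'M[F]_(p, q)) : Prop :=
  (q <= p)%N /\ adjmx V *m V = 1%:M.

(* The size of a matrix made of [m] blocks of size [a] is [\sum_(i < m) a], the
   form used by [\mxblock] and [\mxdiag]; it equals [m * a] by [sum_nat_const]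
   and [card_ord]. *)
Definition diag_copies (m a : nat) (A : 'M[F]_a) : 'M[F]_(\sum_(i < m) a) :=
  \mxdiag_(i < m) A.

End Matrices.

(* Main.v *)
(* Write H = S S with S Hermitian, and view H as I_m tensor H. Take beta
   Hermitian, pairwise anticommuting matrices E_s of order m = 2^beta with
   E_s^2 = 1, a Hadamard matrix (e_js) of order beta = 2^p, and let J_s be the
   s-th block injection. Put T_j = sum_s e_js E_s (x) J_s. As A_st = A_ts, the
   anticommutation cancels the off-diagonal blocks in T_j^* (I (x) H) T_j, which
   is therefore I (x) Delta; orthogonality of the columns of e gives
   sum_j T_j T_j^* = beta I. So C_j = (I (x) S) T_j satisfies
   C_j^* C_j = I (x) Delta and sum_j C_j C_j^* = beta (I (x) H), and the polar
   decomposition C_j = V_j P_j gives C_j C_j^* = V_j C_j^* C_j V_j^*. *)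

Require Import Defs.
From mathcomp Require Import all_boot all_order all_algebra.
From mathcomp Require Import reals complex.

Set Implicit Arguments.
Unset Strict Implicit.
Unset Printing Implicit Defensive.

Import GRing.Theory Num.Theory.
Local Open Scope ring_scope.

(** * Conjugation and square roots, uniformly for the real and complex scalars *)

Section Scalars.
Variables (R : realType) (k : scalar_kind).
Local Notation F := (scalar_field R k).
Local Notation conj := (sconj R k).

Lemma mul_sconj (x : F) : conj x * x = `|x| ^+ 2.
Proof.
case: k x => x /=; first by rewrite real_normK ?num_real// expr2.
by rewrite normCKC.
Qed.

Lemma sconjK : involutive conj.
Proof. by case: k => x //=; rewrite conjCK. Qed.

Lemma sconj_ge0 (x : F) : 0 <= x -> conj x = x.
Proof. by case: k x => x //= /ger0_real/CrealP. Qed.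

Lemma ge0_sqrt (x : F) : 0 <= x -> exists2 y : F, 0 <= y & y ^+ 2 = x.
Proof.
case: k x => x /= x0; last by exists (sqrtC x); rewrite ?sqrtC_ge0 ?sqrtCK.
by exists (Num.sqrt x); rewrite ?sqrtr_ge0 ?sqr_sqrtr.
Qed.

End Scalars.

(** * Adjoints, unit vectors and unitary matrices *)

Section Adjoint.
Variables (R : realType) (k : scalar_kind).
Local Notation F := (scalar_field R k).
Local Notation conj := (sconj R k).

Lemma adjmxE p q (A : 'M[F]_(p, q)) i j : adjmx A i j = conj (A j i).
Proof. by rewrite !mxE. Qed.

Lemma adjmxK p q (A : 'M[F]_(p, q)) : adjmx (adjmx A) = A.
Proof. by apply/matrixP=> i j; rewrite !adjmxE sconjK. Qed.

Lemma adjmxM p q r (A : 'M[F]_(p, q)) (B : 'M[F]_(q, r)) :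
  adjmx (A *m B) = adjmx B *m adjmx A.
Proof. by rewrite /adjmx trmx_mul map_mxM. Qed.

Lemma adjmxD p q (A B : 'M[F]_(p, q)) : adjmx (A + B) = adjmx A + adjmx B.
Proof. by rewrite /adjmx linearD map_mxD. Qed.

Lemma adjmxN p q (A : 'M[F]_(p, q)) : adjmx (- A) = - adjmx A.
Proof. by rewrite /adjmx linearN map_mxN. Qed.

Lemma adjmx0 p q : adjmx (0 : 'M[F]_(p, q)) = 0.
Proof. by rewrite /adjmx trmx0 map_mx0. Qed.

Lemma adjmx_sum p q (I : finType) (f : I -> 'M[F]_(p, q)) :
  adjmx (\sum_i f i) = \sum_i adjmx (f i).
Proof. exact: (big_morph _ (@adjmxD p q) (@adjmx0 p q)). Qed.

Lemma adjmxZ p q a (A : 'M[F]_(p, q)) : adjmx (a *: A) = conj a *: adjmx A.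
Proof. by rewrite /adjmx linearZ map_mxZ. Qed.

Lemma adjmx_scalar p a : adjmx (a%:M : 'M[F]_p) = (conj a)%:M.
Proof. by rewrite /adjmx tr_scalar_mx map_scalar_mx. Qed.

Lemma adjmx1 p : adjmx (1%:M : 'M[F]_p) = 1%:M.
Proof. by rewrite adjmx_scalar rmorph1. Qed.

Lemma adjmx_block p1 p2 q1 q2 (A : 'M[F]_(p1, q1)) (B : 'M[F]_(p1, q2))
    (C : 'M[F]_(p2, q1)) (D : 'M[F]_(p2, q2)) :
  adjmx (block_mx A B C D) =
  block_mx (adjmx A) (adjmx C) (adjmx B) (adjmx D).
Proof. by rewrite /adjmx tr_block_mx map_block_mx. Qed.

Lemma adjmx_col p1 p2 q (A : 'M[F]_(p1, q)) (B : 'M[F]_(p2, q)) :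
  adjmx (col_mx A B) = row_mx (adjmx A) (adjmx B).
Proof. by rewrite /adjmx tr_col_mx map_row_mx. Qed.

Lemma hermitian_mxP n (A : 'M[F]_n) : hermitian_mx A <-> adjmx A = A.
Proof.
rewrite /hermitian_mx is_hermitianmxE expr0 scale1r.
by split=> [/eqP/esym//|h]; apply/eqP/esym.
Qed.

Lemma adjmx_mul_self q (v : 'cV[F]_q) :
  adjmx v *m v = (\sum_i `|v i 0| ^+ 2)%:M.
Proof.
rewrite [LHS]mx11_scalar mxE; congr (_%:M); apply: eq_bigr => i _.
by rewrite adjmxE mul_sconj.
Qed.

Lemma adjmx_mul_gram_ge0 p q (C : 'M[F]_(p, q)) (v : 'cV[F]_q) :
  0 <= (adjmx v *m (adjmx C *m C) *m v) 0 0.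
Proof.
rewrite -!mulmxA mulmxA -adjmxM adjmx_mul_self mxE eqxx mulr1n.
by apply: sumr_ge0 => i _; rewrite exprn_ge0.
Qed.

Lemma adjmx_mul_self_eq0 q (v : 'cV[F]_q) : adjmx v *m v = 0 -> v = 0.
Proof.
rewrite adjmx_mul_self => /matrixP/(_ 0 0); rewrite !mxE eqxx mulr1n.
move/psumr_eq0P => h; apply/colP=> i; rewrite mxE; apply/eqP.
by rewrite -normr_eq0 -sqrf_eq0 h// => j _; rewrite exprn_ge0.
Qed.

Lemma normalize q (v : 'cV[F]_q) : v != 0 ->
  exists2 c : F, c != 0 & adjmx (c *: v) *m (c *: v) = 1%:M.
Proof.
move=> v0; set r := \sum_i `|v i 0| ^+ 2.
have r0 : 0 <= r by apply: sumr_ge0 => i _; rewrite exprn_ge0.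
have [y y0 yr] := ge0_sqrt r0.
have ynz : y != 0.
  apply: contraNneq v0 => yz; apply/eqP/adjmx_mul_self_eq0.
  by rewrite adjmx_mul_self -/r -yr yz expr2 mul0r raddf0.
exists y^-1; first by rewrite invr_eq0.
rewrite adjmxZ sconj_ge0 ?invr_ge0// -scalemxAl -scalemxAr scalerA.
rewrite adjmx_mul_self -/r -yr scale_scalar_mx -invfM -expr2 mulVf//.
by rewrite expf_neq0.
Qed.

Lemma adjmx_unitary n (U : 'M[F]_n) :
  adjmx U *m U = 1%:M -> U *m adjmx U = 1%:M.
Proof. exact: mulmx1C. Qed.

(** For a unit eigenvector [v], the 1 by 1 matrix [v^* A v] equals [a] and is its own adjoint. *)
Lemma hermitian_eigenvalue_real n (A : 'M[F]_n) a (v : 'cV[F]_n) :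
  adjmx A = A -> v != 0 -> A *m v = a *: v -> conj a = a.
Proof.
move=> hA /normalize[c c0 vv1] Av.
have Acv : A *m (c *: v) = a *: (c *: v).
  by rewrite -scalemxAr Av !scalerA mulrC.
have e : adjmx (c *: v) *m A *m (c *: v) = a%:M.
  by rewrite -mulmxA Acv -scalemxAr vv1 scalemx1.
move: (congr1 (@adjmx R k _ _) e).
rewrite !adjmxM hA adjmxK mulmxA e adjmx_scalar.
by move/matrixP/(_ 0 0); rewrite !mxE eqxx !mulr1n.
Qed.

(* For [v = e_1] up to a phase this is the reflection through [v + phi e_1],
   where the phase [phi] of the first entry of [v] keeps that vector nonzero. *)
Lemma unit_vector_first_column n (v : 'cV[F]_(1 + n)) :
  adjmx v *m v = 1%:M ->
  exists2 U : 'M[F]_(1 + n), adjmx U *m U = 1%:M & U *m col_mx 1%:M 0 = v.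
Proof.
move=> vv; set e1 : 'cV[F]_(1 + n) := col_mx 1%:M 0.
pose v0 := v 0 0.
have [phi phi1 phiv] : exists2 phi, conj phi * phi = 1 & conj phi * v0 = `|v0|.
  have [z|nz] := eqVneq v0 0.
    by exists 1; rewrite ?rmorph1 ?mulr1// z normr0 mulr0.
  have nnz : `|v0| != 0 by rewrite normr_eq0.
  have cn : conj `|v0|^-1 = `|v0|^-1 by rewrite sconj_ge0 ?invr_ge0.
  exists (v0 / `|v0|); rewrite rmorphM cn.
    rewrite mulrACA mul_sconj -invfM -expr2 divff// expf_neq0//.
  by rewrite mulrAC mul_sconj expr2 mulfK.
have ev : adjmx e1 *m v = v0%:M.
  rewrite adjmx_col adjmx1 adjmx0 -[v]vsubmxK mul_row_col mul0mx addr0 mul1mx.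
  rewrite [LHS]mx11_scalar /v0 !mxE; congr (v _ _)%:M; exact: val_inj.
have ee : adjmx e1 *m e1 = 1%:M.
  by rewrite adjmx_col adjmx1 adjmx0 mul_row_col mul0mx addr0 mul1mx.
have ve : adjmx v *m e1 = (conj v0)%:M.
  by rewrite -[adjmx v *m _]adjmxK adjmxM adjmxK ev adjmx_scalar.
have conj_phiv : phi * conj v0 = `|v0|.
  by rewrite -[LHS]sconjK rmorphM sconjK phiv sconj_ge0.
pose w := v + phi *: e1.
pose s := 1 + `|v0|.
have s0 : s != 0 by rewrite lt0r_neq0// ltr_wpDr.
have wv : adjmx w *m v = s%:M.
  by rewrite adjmxD adjmxZ mulmxDl vv -scalemxAl ev scale_scalar_mx phiv raddfD.
have ww : adjmx w *m w = (s + s)%:M.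
  rewrite {2}/w mulmxDr wv -scalemxAr adjmxD adjmxZ mulmxDl ve -scalemxAl ee.
  rewrite scalerDr scalerA !scale_scalar_mx mulr1 conj_phiv mulrC phi1.
  by rewrite -!raddfD /= [`|v0| + 1]addrC.
have cs : conj s^-1 = s^-1 by rewrite sconj_ge0// invr_ge0 addr_ge0.
(* Since [w^* w = 2 s], this is the Householder reflection that negates [w]; since [w^* v = s], it
   sends [v] to [v - w = - phi e1]. *)
pose K := 1%:M - s^-1 *: (w *m adjmx w).
have adjK : adjmx K = K.
  by rewrite adjmxD adjmxN adjmxZ adjmxM adjmxK adjmx1 cs.
have Kv : K *m v = - phi *: e1.
  rewrite mulmxBl mul1mx -scalemxAl -mulmxA wv mul_mx_scalar scalerA mulVf//.
  by rewrite scale1r opprD addrA subrr add0r scaleNr.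
have KK : K *m K = 1%:M.
  rewrite {2}/K mulmxBr mulmx1 -scalemxAr mulmxA.
  have -> : K *m w = - w.
    rewrite mulmxBl mul1mx -scalemxAl -mulmxA ww mul_mx_scalar scalerA.
    by rewrite mulrDr mulVf// scalerDl scale1r opprD addrA subrr add0r.
  by rewrite mulNmx scalerN opprK subrK.
(* [K] is an involution, so it sends [- phi e1] back to [v]; the unimodular factor [- phi] keeps the
   matrix unitary. *)
exists (- phi *: K).
  rewrite adjmxZ adjK -scalemxAl -scalemxAr scalerA KK rmorphN mulrNN phi1.
  by rewrite scale1r.
by rewrite -scalemxAl scalemxAr -Kv mulmxA KK mul1mx.
Qed.

Lemma block_mx_deflate p q (M : 'M[F]_(1 + p, 1 + q)) a :
  M *m col_mx 1%:M 0 = a *: col_mx 1%:M 0 ->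
  row_mx 1%:M 0 *m M = a *: row_mx 1%:M 0 ->
  M = block_mx a%:M 0 0 (drsubmx M).
Proof.
move=> hc hr; rewrite -[M]submxK mul_block_col in hc.
rewrite -[M]submxK mul_row_block in hr; move: hc hr.
rewrite !mulmx1 !mulmx0 !mul1mx !mul0mx !addr0.
rewrite scale_col_mx scale_row_mx !scaler0 scalemx1.
move=> /eq_col_mx[eul edl] /eq_row_mx[_ eur].
by rewrite -[LHS]submxK eul edl eur.
Qed.

End Adjoint.

(** * Existence of eigenvectors over both fields *)

Lemma complex_hermitian_eigenvector (R : realType) n (A : 'M[R[i]]_n.+1) :
  exists a, exists2 v : 'cV[R[i]]_n.+1, v != 0 & A *m v = a *: v.
Proof.
(* [eigenvalue] is about row vectors, hence the transpose. *)
have [a] := eigenvalue_closed A^T (ltn0Sn n).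
move/eigenvalueP=> [v vA v0]; exists a, v^T; first by rewrite trmx_eq0.
by rewrite -[A]trmxK -trmx_mul vA linearZ.
Qed.

(** In the real case the matrix is complexified: its complex eigenvalue is real because the matrix
    is Hermitian, and being an eigenvalue descends along the field embedding, which yields a real
    eigenvector. *)
Lemma hermitian_eigenvector (R : realType) (k : scalar_kind) n
    (A : 'M[scalar_field R k]_n.+1) : adjmx A = A ->
  exists a, exists2 v : 'cV[scalar_field R k]_n.+1, v != 0 & A *m v = a *: v.
Proof.
case: k A => [|] A hA; last exact: complex_hermitian_eigenvector.
pose Ac : 'M[R[i]]_n.+1 := map_mx (real_complex R) A.
have [a [v v0 Av]] := complex_hermitian_eigenvector Ac.
have hAc : @adjmx R ComplexScalars _ _ Ac = Ac.
  apply/matrixP=> i j; rewrite adjmxE !mxE /=.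
  move/matrixP/(_ i j): hA; rewrite adjmxE /= => ->.
  by apply/CrealP; rewrite complex_real.
have /CrealP/complex_realP[b ab] := hermitian_eigenvalue_real hAc v0 Av.
have : eigenvalue (map_mx (real_complex R) A^T) (real_complex R b).
  apply/eigenvalueP; exists v^T; last by rewrite trmx_eq0.
  by rewrite -map_trmx -trmx_mul Av -ab linearZ.
rewrite eigenvalue_map => /eigenvalueP[w wA w0].
exists b, w^T; first by rewrite trmx_eq0.
by rewrite -[A]trmxK -trmx_mul wA linearZ.
Qed.

(** * Square roots and polar decomposition, by deflation *)

Section Polar.
Variables (R : realType) (k : scalar_kind).
Local Notation F := (scalar_field R k).
Local Notation conj := (sconj R k).

Lemma hermitian_unit_eigenvector n (A : 'M[F]_(1 + n)) : adjmx A = A ->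
  exists a, exists2 v : 'cV[F]_(1 + n),
    adjmx v *m v = 1%:M & A *m v = a *: v.
Proof.
move=> /hermitian_eigenvector[a [v /normalize[c _ vv] Av]].
by exists a, (c *: v) => //; rewrite -scalemxAr Av !scalerA mulrC.
Qed.

(** Common induction step of the two decompositions below: [u] and [v] form a pair of singular
    vectors for [s], and in bases starting with them [C] splits off the scalar [s]. *)
Lemma unitary_deflate p q (C : 'M[F]_(1 + p, 1 + q)) (U : 'M[F]_(1 + p))
    (V : 'M[F]_(1 + q)) (u : 'cV[F]_(1 + p)) (v : 'cV[F]_(1 + q)) s :
  adjmx U *m U = 1%:M -> adjmx V *m V = 1%:M ->
  U *m col_mx 1%:M 0 = u -> V *m col_mx 1%:M 0 = v ->
  C *m v = s *: u -> adjmx u *m C = s *: adjmx v ->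
  exists D : 'M[F]_(p, q), adjmx U *m C *m V = block_mx s%:M 0 0 D.
Proof.
move=> UU VV Ue Ve Cv uC; set M := adjmx U *m C *m V.
exists (drsubmx M); apply: block_mx_deflate.
  by rewrite /M -!mulmxA Ve Cv -Ue -scalemxAr mulmxA UU mul1mx.
have -> : row_mx 1%:M 0 = adjmx (col_mx 1%:M 0 : 'cV[F]_(1 + p)).
  by rewrite adjmx_col adjmx1 adjmx0.
rewrite /M !mulmxA -adjmxM Ue uC -scalemxAl -Ve adjmxM -mulmxA VV mulmx1.
by rewrite !adjmx_col !adjmx1 !adjmx0.
Qed.

Lemma unitary_cancel p q (U : 'M[F]_p) (V : 'M[F]_q) (C M : 'M[F]_(p, q)) :
  adjmx U *m U = 1%:M -> adjmx V *m V = 1%:M ->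
  adjmx U *m C *m V = M -> C = U *m M *m adjmx V.
Proof.
move=> UU VV <-; rewrite !mulmxA adjmx_unitary// mul1mx -mulmxA.
by rewrite adjmx_unitary// mulmx1.
Qed.

(** Induction on the order: a unit eigenvector splits off its eigenvalue [a >= 0], and the remaining
    block is again positive semi-definite. *)
Lemma psd_sqrt n (A : 'M[F]_n) : psd_mx A ->
  exists2 S : 'M[F]_n, adjmx S = S & S *m S = A.
Proof.
elim: n A => [|n IH] A [/hermitian_mxP hA pA].
  by exists 0; rewrite ?adjmx0// [A]flatmx0 mul0mx.
have [a [v vv Av]] := @hermitian_unit_eigenvector n A hA.
have va : adjmx v *m A *m v = a%:M.
  by rewrite -mulmxA Av -scalemxAr vv scalemx1.
have a0 : 0 <= a by have := pA v; rewrite va mxE mulr1n.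
have vA : adjmx v *m A = a *: adjmx v.
  by rewrite -[LHS]adjmxK adjmxM adjmxK hA Av adjmxZ sconj_ge0.
have [U UU Ue] := unit_vector_first_column vv.
have [D UAU] := @unitary_deflate n n A U U v v a UU UU Ue Ue Av vA.
have hUAU : adjmx (adjmx U *m A *m U) = adjmx U *m A *m U.
  by rewrite !adjmxM hA adjmxK mulmxA.
have hD : adjmx D = D.
  by move: hUAU; rewrite UAU adjmx_block => /eq_block_mx[].
have [|S hS SS] := IH D.
  split=> [|x]; first exact/hermitian_mxP.
  (* Padding [x] with a zero turns the quadratic form of [D] at [x] into that of [A] at [U y]. *)
  pose y : 'cV[F]_(1 + n) := col_mx 0 x.
  have <- : adjmx (U *m y) *m A *m (U *m y) = adjmx x *m D *m x; last exact: pA.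
  transitivity (adjmx y *m (adjmx U *m A *m U) *m y).
    by rewrite adjmxM !mulmxA.
  rewrite UAU adjmx_col adjmx0 mul_row_block mul_row_col.
  by rewrite !mul0mx !mulmx0 !add0r.
have [t t0 ta] := ge0_sqrt a0.
pose T : 'M[F]_(1 + n) := block_mx t%:M 0 0 S.
exists (U *m T *m adjmx U).
  rewrite !adjmxM adjmxK adjmx_block !adjmx0 adjmx_scalar sconj_ge0// hS.
  by rewrite mulmxA.
rewrite (unitary_cancel UU UU UAU) -!mulmxA [adjmx U *m _]mulmxA UU mul1mx.
rewrite [T *m _]mulmxA /T mulmx_block !mulmx0 !mul0mx !addr0 add0r SS.
by rewrite -scalar_mxM -expr2 ta.
Qed.

(** Induction splitting off one singular value at a time. With [W] an isometry and [P] Hermitian,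
    [C^* C = P P], whence [C C^* = W (C^* C) W^*]. *)
Lemma polar_decomposition p q (C : 'M[F]_(p, q)) : (q <= p)%N ->
  exists W : 'M[F]_(p, q), exists2 P : 'M[F]_q,
    adjmx W *m W = 1%:M /\ adjmx P = P & C = W *m P.
Proof.
elim: q p C => [|q IH] [|p] C //.
- move=> _; exists 0, 0; last by rewrite [C]flatmx0 [RHS]flatmx0.
  by split; rewrite ?adjmx0// [LHS]flatmx0 [RHS]flatmx0.
- move=> _; exists 0, 0; last by rewrite [C]thinmx0 [RHS]thinmx0.
  by split; rewrite ?adjmx0// [LHS]flatmx0 [RHS]flatmx0.
rewrite ltnS => qp.
have [|a [v vv Av]] := @hermitian_unit_eigenvector q (adjmx C *m C).
  by rewrite adjmxM adjmxK.
have va : adjmx (C *m v) *m (C *m v) = a%:M.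
  by rewrite adjmxM -mulmxA [adjmx C *m _]mulmxA Av -scalemxAr vv scalemx1.
have a0 : 0 <= a.
  have := adjmx_mul_gram_ge0 C v.
  by rewrite -mulmxA Av -scalemxAr vv scalemx1 mxE mulr1n.
have [s s0 sa] := ge0_sqrt a0.
(* The left singular vector is [C v / s] when [s] is nonzero, and otherwise a unit vector with
   [u^* C = 0]. *)
have [u [uu Cv uC]] : exists u : 'cV[F]_p.+1,
    [/\ adjmx u *m u = 1%:M, C *m v = s *: u & adjmx u *m C = s *: adjmx v].
  have [z|nz] := eqVneq s 0.
    have Cv : C *m v = 0.
      by apply: adjmx_mul_self_eq0; rewrite va -sa z expr2 mul0r raddf0.
    (* [C] is not injective, so [q <= p] gives it a nonzero left kernel. *)
    have nfree : ~~ row_free C.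
      apply/negP=> freeC.
      (* Independent rows give rank [p + 1 >= q + 1], hence a left inverse of [C], and then
         [C v = 0] contradicts that [v] is a unit vector. *)
      have fullC : row_full C.
        move: freeC; rewrite /row_free /row_full eqn_leq => /andP[_ h].
        by rewrite eqn_leq rank_leq_col (leq_trans _ h).
      have /row_fullP[B BC] := fullC.
      have v0 : v = 0 by rewrite -[v]mul1mx -BC -mulmxA Cv mulmx0.
      move: vv; rewrite v0 mulmx0 => /matrixP/(_ 0 0); rewrite !mxE.
      by move/eqP; rewrite eq_sym oner_eq0.
    have : kermx C != 0 by rewrite kermx_eq0.
    case/rowV0Pn=> w /sub_kermxP wC w0.
    have [|c c0 uu] := @normalize _ _ _ (adjmx w).
      by apply: contraNneq w0 => w0; rewrite -[w]adjmxK w0 adjmx0.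
    exists (c *: adjmx w); split=> //; rewrite z scale0r//.
    by rewrite adjmxZ adjmxK -scalemxAl wC scaler0.
  have cs : conj s^-1 = s^-1 by rewrite sconj_ge0 ?invr_ge0.
  exists (s^-1 *: (C *m v)); split.
  - rewrite adjmxZ cs -scalemxAl -scalemxAr va scalerA -sa scale_scalar_mx.
    by rewrite -invfM -expr2 mulVf// expf_neq0.
  - by rewrite scalerA mulfV// scale1r.
  rewrite adjmxZ cs -scalemxAl.
  have -> : adjmx (C *m v) *m C = a *: adjmx v.
    by rewrite -[LHS]adjmxK adjmxM adjmxK mulmxA Av adjmxZ sconj_ge0.
  by rewrite scalerA -sa expr2 mulKf.
have [U UU Ue] := @unit_vector_first_column R k p u uu.
have [V VV Ve] := @unit_vector_first_column R k q v vv.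
have [D UCV] := @unitary_deflate p q C U V u v s UU VV Ue Ve Cv uC.
have [W [P [WW hP] DE]] := IH _ D qp.
(* The singular value goes into [P'] and a 1 into [W'], so that [W'] is an isometry even when
   [s = 0]. *)
pose W' : 'M[F]_(1 + p, 1 + q) := block_mx 1%:M 0 0 W.
pose P' : 'M[F]_(1 + q) := block_mx s%:M 0 0 P.
have WW' : adjmx W' *m W' = 1%:M.
  rewrite adjmx_block mulmx_block !adjmx0 adjmx1.
  by rewrite !mulmx0 !mul0mx mul1mx WW !addr0 add0r -scalar_mx_block.
have hP' : adjmx P' = P'.
  by rewrite adjmx_block !adjmx0 adjmx_scalar sconj_ge0// hP.
exists (U *m W' *m adjmx V), (V *m P' *m adjmx V); first split.
- rewrite !adjmxM adjmxK -!mulmxA [adjmx U *m _]mulmxA UU mul1mx.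
  by rewrite [adjmx W' *m _]mulmxA WW' mul1mx adjmx_unitary.
- by rewrite !adjmxM adjmxK hP' mulmxA.
rewrite (unitary_cancel UU VV UCV) -!mulmxA [adjmx V *m _]mulmxA VV mul1mx.
rewrite [W' *m _]mulmxA /W' /P' mulmx_block.
by rewrite !mulmx0 !mul0mx mul1mx !addr0 add0r -DE.
Qed.
End Polar.

(** * Kronecker products *)

Section Kronecker.
Variables (R : realType) (k : scalar_kind).
Local Notation F := (scalar_field R k).

(** The left factor indexes the blocks, so that an identity there gives [diag_copies], with the same
    form of the sizes. *)
Definition kron p q a b (W : 'M[F]_(p, q)) (X : 'M[F]_(a, b)) :
    'M[F]_(\sum_(i < p) a, \sum_(j < q) b) :=
  \mxblock_(i, j) (W i j *: X).

Lemma kronM p q r a b c (W : 'M[F]_(p, q)) (W' : 'M[F]_(q, r))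
    (X : 'M[F]_(a, b)) (X' : 'M[F]_(b, c)) :
  kron W X *m kron W' X' = kron (W *m W') (X *m X').
Proof.
rewrite /kron mul_mxblock; apply: eq_mxblock => i l.
rewrite mxE scaler_suml; apply: eq_bigr => j _.
by rewrite -scalemxAl -scalemxAr scalerA.
Qed.

Lemma adjmx_kron p q a b (W : 'M[F]_(p, q)) (X : 'M[F]_(a, b)) :
  adjmx (kron W X) = kron (adjmx W) (adjmx X).
Proof. by apply/matrixP=> i j; rewrite !mxE rmorphM. Qed.

Lemma kronDr p q a b (W : 'M[F]_(p, q)) (X X' : 'M[F]_(a, b)) :
  kron W (X + X') = kron W X + kron W X'.
Proof. by apply/matrixP=> i j; rewrite !mxE mulrDr. Qed.

Lemma kron0r p q a b (W : 'M[F]_(p, q)) : kron W (0 : 'M_(a, b)) = 0.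
Proof. by apply/matrixP=> i j; rewrite !mxE mulr0. Qed.

Lemma kron_sumr p q a b (I : finType) (W : 'M[F]_(p, q))
    (X : I -> 'M[F]_(a, b)) :
  kron W (\sum_i X i) = \sum_i kron W (X i).
Proof. exact: (big_morph _ (kronDr W) (@kron0r _ _ _ _ W)). Qed.

Lemma kron1_diag_copies m a (A : 'M[F]_a) :
  kron (1%:M : 'M_m) A = diag_copies m A.
Proof.
rewrite /kron /diag_copies /mxdiag; apply: eq_mxblock => i j.
by rewrite mxE; case: eqP => _; rewrite ?scale1r ?scale0r ?conform_mx_id.
Qed.

Lemma kron11 m a : kron (1%:M : 'M_m) (1%:M : 'M_a) = 1%:M.
Proof. by rewrite kron1_diag_copies /diag_copies mxdiagZ. Qed.

End Kronecker.

(** * Anticommuting generators and Hadamard matrices *)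

Section SignMatrices.
Variables (R : realType) (k : scalar_kind).
Local Notation F := (scalar_field R k).

(** Each doubling of the order makes room for one more generator: the old ones become
    [E_i (+) (- E_i)], and the swap of the two halves anticommutes with all of these. *)
Lemma clifford_generators b m : m = (2 ^ b)%N ->
  exists E : nat -> 'M[F]_m,
    [/\ forall i, adjmx (E i) = E i, forall i, E i *m E i = 1%:M
      & forall i j, (i < j < b)%N -> E i *m E j = - (E j *m E i)].
Proof.
elim: b m => [|b IH] m.
  move=> _; exists (fun _ => 1%:M); split=> [i|i|i j]; first exact: adjmx1.
    exact: mulmx1.
  by rewrite ltn0 andbF.
rewrite expnS mul2n -addnn => ->.
have [E [hE EE anti]] := IH _ (erefl _).
(* The swap is the generator of index [b]; it is also the value at all larger indices, where
   anticommutation is not claimed. *)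
exists (fun i => if (i < b)%N then block_mx (E i) 0 0 (- E i)
                 else block_mx 0 1%:M 1%:M 0).
split=> [i|i|i j /andP[ij]].
- by case: ifP => _; rewrite adjmx_block !adjmx0 ?adjmx1 ?adjmxN ?hE.
- by case: ifP => _; rewrite mulmx_block !mulmx0 !mul0mx ?mulmx1 ?mulNmx
    ?mulmxN ?opprK ?EE !addr0 ?add0r -scalar_mx_block.
rewrite ltnS leq_eqVlt => /predU1P[jb|jb].
  rewrite jb in ij *; rewrite ij ltnn !mulmx_block opp_block_mx.
  by rewrite !mulmx0 !mul0mx !mulmx1 !mul1mx !addr0 !add0r oppr0 opprK.
rewrite jb (ltn_trans ij jb) !mulmx_block opp_block_mx.
rewrite !mulmx0 !mul0mx !mulNmx !mulmxN !opprK !addr0 !add0r oppr0.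
by rewrite (anti i j) ?ij// opprK.
Qed.

(** Sylvester's doubling of [e] into the blocks [e, e, e, - e]. Equality of adjoint and transpose
    records that the entries are real. *)
Lemma hadamard_sylvester p b : b = (2 ^ p)%N ->
  exists2 e : 'M[F]_b, adjmx e *m e = b%:R%:M /\ adjmx e = e^T
    & forall i j, e i j ^+ 2 = 1.
Proof.
elim: p b => [|p IH] b.
  move=> ->; exists 1%:M; first by rewrite adjmx1 mulmx1 trmx1.
  by move=> i j; rewrite !ord1 mxE expr1n.
rewrite expnS mul2n -addnn => ->.
have [e [ee eT] e2] := IH _ (erefl _).
exists (block_mx e e e (- e)); last first.
  move=> i j; rewrite -(splitK i) -(splitK j).
  case: (split i) (split j) => i' [] j'; rewrite /= ?(block_mxEul,
   block_mxEur, block_mxEdl, block_mxEdr) ?e2// mxE sqrrN e2//.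
split; last by rewrite adjmx_block tr_block_mx adjmxN eT linearN.
rewrite adjmx_block mulmx_block adjmxN !mulNmx !mulmxN opprK ee subrr.
by rewrite -raddfD /= -natrD -scalar_mx_block.
Qed.
End SignMatrices.

(** Exchanging the two indices shows that the off-diagonal part [Y] equals [- Y], so it vanishes
    because 2 is invertible. *)
Lemma sum_antisym_offdiag (F : numFieldType) (V : lmodType F) (I : finType)
    (g : I -> I -> V) : (forall s t, s != t -> g s t = - g t s) ->
  \sum_s \sum_t g s t = \sum_s g s s.
Proof.
move=> anti; pose Y := \sum_s \sum_(t | s != t) g s t.
have YN : Y = - Y.
  rewrite {1}/Y (exchange_big_dep xpredT)//= -sumrN; apply: eq_bigr => t _.
  by rewrite -sumrN; apply: eq_big => [s|s /anti//]; rewrite eq_sym.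
have Y0 : Y = 0.
  have : 2%:R *: Y == 0 by rewrite scaler_nat mulr2n {1}YN addNr.
  by rewrite scaler_eq0 pnatr_eq0 => /eqP.
have -> : \sum_s g s s = \sum_s g s s + Y by rewrite Y0 addr0.
rewrite -big_split/=; apply: eq_bigr => s _.
by rewrite (bigD1 s)//=; congr (_ + _); apply: eq_bigl => t; rewrite eq_sym.
Qed.

(** * Block injections *)

Section BlockInjection.
Variables (R : realType) (k : scalar_kind) (b n : nat).
Local Notation F := (scalar_field R k).

(** The injection [J_s] of the s-th summand: a column of blocks with the identity at position [s]
    and zero elsewhere. *)
Definition block_inj (s : 'I_b) : 'M[F]_(\sum_(t < b) n, n) :=
  \mxcol_(t < b) (t == s)%:R%:M.

Lemma adjmx_block_inj s :
  adjmx (block_inj s) = \mxrow_(t < b) (t == s)%:R%:M.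
Proof.
rewrite /adjmx /block_inj tr_mxcol; apply/matrixP=> i j.
rewrite !mxE rmorphMn rmorph_nat; congr (_ *+ _).
by rewrite eq_sym.
Qed.

Lemma block_inj_mxblock (A : 'I_b -> 'I_b -> 'M[F]_n) s t :
  adjmx (block_inj s) *m \mxblock_(i, j) A i j *m block_inj t = A s t.
Proof.
rewrite adjmx_block_inj mul_mxrow_mxblock mul_mxrow_mxcol (bigD1 t)//=.
rewrite eqxx mulmx1 [X in _ + X]big1 => [|j /negPf ->]; last first.
  by rewrite mul_mx_scalar scale0r.
rewrite addr0 (bigD1 s)//= eqxx mul1mx big1 ?addr0// => i /negPf ->.
by rewrite mul_scalar_mx scale0r.
Qed.

(** Resolution of the identity: each summand is the projection onto one block. *)
Lemma sum_block_inj : \sum_s block_inj s *m adjmx (block_inj s) = 1%:M.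
Proof.
transitivity (kron (1%:M : 'M[F]_b) (1%:M : 'M[F]_n)); last exact: kron11.
transitivity (\sum_s \mxblock_(i < b, j < b)
    ((i == s)%:R%:M *m ((j == s)%:R%:M : 'M[F]_n))).
  by apply: eq_bigr => s _; rewrite adjmx_block_inj mul_mxcol_mxrow.
rewrite -mxblock_sum; apply: eq_mxblock => i j.
rewrite (bigD1 j)//= eqxx mulmx1 big1 ?addr0 ?mxE ?scalemx1// => s.
by rewrite eq_sym => /negPf ->; rewrite mul_mx_scalar scale0r.
Qed.

End BlockInjection.

(** * The signed columns [T_j] and their two identities *)

Section Compression.
Variables (R : realType) (k : scalar_kind) (b m n : nat).
Local Notation F := (scalar_field R k).
Variables (E : nat -> 'M[F]_m) (e : 'M[F]_b).
Hypotheses (hE : forall i, adjmx (E i) = E i)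
  (EE : forall i, E i *m E i = 1%:M)
  (anti : forall i j, (i < j < b)%N -> E i *m E j = - (E j *m E i))
  (ee : adjmx e *m e = b%:R%:M) (eT : adjmx e = e^T)
  (e2 : forall i j, e i j ^+ 2 = 1).

Definition signed_column (j : 'I_b) :
    'M[F]_(\sum_(i < m) \sum_(s < b) n, \sum_(i < m) n) :=
  \sum_s e j s *: kron (E s) (block_inj R k n s).

Lemma adjmx_signed_column j : adjmx (signed_column j) =
  \sum_s e j s *: kron (E s) (adjmx (block_inj R k n s)).
Proof.
rewrite adjmx_sum; apply: eq_bigr => s _; rewrite adjmxZ adjmx_kron hE.
by rewrite -adjmxE eT mxE.
Qed.

(** The product expands into terms [e_js e_jt (E_s E_t (x) A_st)]. Off the diagonal they are
    antisymmetric in [s, t], as [E_s E_t = - E_t E_s] and [A_st = A_ts]; on it the squares [e_js^2]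
    and [E_s^2] are 1. *)
Lemma signed_column_compress (A : 'I_b -> 'I_b -> 'M[F]_n) j :
  (forall s t, A s t = A t s) ->
  adjmx (signed_column j) *m kron 1%:M (\mxblock_(s, t) A s t)
    *m signed_column j = kron 1%:M (\sum_s A s s).
Proof.
move=> symA; rewrite adjmx_signed_column !mulmx_suml.
pose g (s t : 'I_b) := (e j s * e j t) *: kron (E s *m E t) (A s t).
transitivity (\sum_s \sum_t g s t).
  apply: eq_bigr => s _; rewrite mulmx_sumr; apply: eq_bigr => t _.
  rewrite -!scalemxAl -scalemxAr scalerA !kronM mulmx1.
  by rewrite block_inj_mxblock.
rewrite sum_antisym_offdiag => [|s t st].
  rewrite kron_sumr; apply: eq_bigr => s _.
  by rewrite /g EE -expr2 e2 scale1r.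
have Est : E s *m E t = - (E t *m E s).
  case: (ltngtP s t) => [h|h|/val_inj h]; last by rewrite h eqxx in st.
    by apply: anti; rewrite h ltn_ord.
  by rewrite (anti (i := t)) ?opprK// h ltn_ord.
rewrite /g Est symA mulrC -scalerN; congr (_ *: _).
by apply/matrixP=> x y; rewrite !mxE mulNr.
Qed.

(** Summing over [j] first, orthogonality of the columns of [e] leaves only the terms with [s = t],
    each with factor [b]; the block projections then add up to the identity. *)
Lemma sum_signed_column :
  \sum_j signed_column j *m adjmx (signed_column j) = b%:R *: 1%:M.
Proof.
pose g (j s t : 'I_b) := (e j s * e j t) *:
  kron (E s *m E t) (block_inj R k n s *m adjmx (block_inj R k n t)).
have exch (V : zmodType) (f : 'I_b -> 'I_b -> 'I_b -> V) :
    \sum_j \sum_s \sum_t f j s t = \sum_s \sum_t \sum_j f j s t.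
  by rewrite exchange_big; apply: eq_bigr => s _; apply: exchange_big.
transitivity (\sum_s \sum_t \sum_j g j s t).
  rewrite -exch; apply: eq_bigr => j _.
  rewrite adjmx_signed_column mulmx_suml; apply: eq_bigr => s _.
  rewrite mulmx_sumr; apply: eq_bigr => t _.
  by rewrite -scalemxAl -scalemxAr scalerA kronM.
(* This is [e^* e = b] read entrywise; no conjugate appears since [e^*] is the transpose. *)
have orth s t : \sum_j e j s * e j t = b%:R *+ (s == t).
  transitivity ((adjmx e *m e) s t); last by rewrite ee mxE.
  by rewrite eT mxE; apply: eq_bigr => j _; rewrite mxE.
transitivity (\sum_(s < b) b%:R *: kron (1%:M : 'M[F]_m)
    (block_inj R k n s *m adjmx (block_inj R k n s))); last first.
  by rewrite -scaler_sumr -kron_sumr sum_block_inj kron11.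
have diag (V : nmodType) (f : 'I_b -> V) s :
    (forall t, t != s -> f t = 0) -> \sum_t f t = f s.
  by move=> f0; rewrite (bigD1 s)//= big1 ?addr0.
have gE s t : \sum_j g j s t = (b%:R *+ (s == t)) *:
    kron (E s *m E t) (block_inj R k n s *m adjmx (block_inj R k n t)).
  by rewrite /g -scaler_suml orth.
apply: eq_bigr => s _; transitivity (\sum_j g j s s).
  by apply: diag => t; rewrite eq_sym => /negPf st; rewrite gE st scale0r.
by rewrite gE eqxx EE.
Qed.

End Compression.

(** * Assembly of the isometries *)

Theorem theorem2p1 (R : realType) (k : scalar_kind) (p n beta m : nat)
    (hbeta : beta = (2 ^ p)%N) (hm : m = (2 ^ beta)%N)
    (A : 'I_beta -> 'I_beta -> 'M[scalar_field R k]_n)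
    (hA : forall s t : 'I_beta, hermitian_mx (A s t))
    (H : 'M[scalar_field R k]_(\sum_(s < beta) n))
    (hH : H = \mxblock_(s < beta, t < beta) A s t)
    (psdH : psd_mx H)
    (Delta : 'M[scalar_field R k]_n)
    (hDelta : Delta = \sum_(s < beta) A s s) :
  exists V : 'I_beta ->
      'M[scalar_field R k]_(\sum_(i < m) \sum_(s < beta) n, \sum_(i < m) n),
    (forall j : 'I_beta, isometry_mx (V j)) /\
    diag_copies m H = (beta%:R)^-1 *:
      \sum_(j < beta) (V j *m diag_copies m Delta *m adjmx (V j)).
Proof.
(* As [H] is Hermitian, the adjoint of [A s t] is [A t s]; as the block is Hermitian, that adjoint
   is [A s t] itself. *)
have symA s t : A s t = A t s.
  have /hermitian_mxP adjH := psdH.1; have /hermitian_mxP <- := hA s t.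
  rewrite -[A s t]block_inj_mxblock -hH !adjmxM adjmxK adjH hH mulmxA.
  exact: block_inj_mxblock.
have [E [hE EE anti]] := clifford_generators R k hm.
have [e [ee eT] e2] := hadamard_sylvester R k hbeta.
have [S hS SS] := psd_sqrt psdH.
pose C j := kron 1%:M S *m signed_column n E e j.
have beta_gt0 : (0 < beta)%N by rewrite hbeta expn_gt0.
(* The shape condition of the polar decomposition, from [n <= beta * n] as [beta > 0]. *)
have le_dim : (\sum_(i < m) n <= \sum_(i < m) \sum_(s < beta) n)%N.
  by apply: leq_sum => i _; rewrite sum_nat_const card_ord leq_pmull.
have hS1 : adjmx (kron (1%:M : 'M_m) S) = kron 1%:M S.
  by rewrite adjmx_kron adjmx1 hS.
have SS1 : kron (1%:M : 'M_m) S *m kron 1%:M S = kron 1%:M H.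
  by rewrite kronM mulmx1 SS.
have CC j : adjmx (C j) *m C j = diag_copies m Delta.
  rewrite adjmxM hS1 -mulmxA [kron _ _ *m _]mulmxA SS1 mulmxA hH.
  by rewrite signed_column_compress// hDelta kron1_diag_copies.
(* With [C_j = V P], the middle factor [C_j^* C_j] is [P P], so [V (C_j^* C_j) V^* = C_j C_j^*]. *)
have polarC j : exists V, isometry_mx V /\
    C j *m adjmx (C j) = V *m diag_copies m Delta *m adjmx V.
  have [V [P [VV hP] CE]] := polar_decomposition (C j) le_dim.
  exists V; split=> //; rewrite -(CC j) CE !adjmxM hP.
  by rewrite !mulmxA -[_ *m adjmx V *m V]mulmxA VV mulmx1.
have [V hV] := fin_all_exists polarC.
exists V; split=> [j|]; first exact: (hV j).1.
pose T j := signed_column n E e j.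
(* Each summand is [C_j C_j^*], so the fixed outer factors [I (x) S] can be pulled out and the sum
   of the [T_j T_j^*] becomes the scalar [beta]. *)
have -> : \sum_j V j *m diag_copies m Delta *m adjmx (V j) =
    \sum_j kron 1%:M S *m (T j *m adjmx (T j)) *m kron 1%:M S.
  by apply: eq_bigr => j _; rewrite -(hV j).2 adjmxM hS1 !mulmxA.
rewrite -mulmx_suml -mulmx_sumr sum_signed_column//.
rewrite -scalemxAr mulmx1 -scalemxAl SS1 scalerA mulVf ?scale1r.
  by rewrite kron1_diag_copies.
by rewrite pnatr_eq0 -lt0n.
Qed.
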